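(* The linear map $\psi:\mathcal{T}\to\mathfrak{S}$ defined by $$\psi(L_m)=\tfrac12 L_{2m},\qquad \psi(I_m)=I_{2m},\qquad \psi(G_{m+\frac12})=G_{2m+1}\qquad (m\in\mathbb{Z})$$ is an injective homomorphism of Lie superalgebras. Consequently the super Heisenberg-Virasoro algebra $\mathcal{T}$ of Neveu-Schwarz type is isomorphic to a subalgebra of the super Heisenberg-Virasoro algebra $\mathfrak{S}$ of Ramond type.
   Context: Everything is over $\mathbb{C}$. The super Heisenberg-Virasoro algebra of Ramond type $\mathfrak{S}$ is the Lie superalgebra with basis $\{L_m,I_m,G_m\mid m\in\mathbb{Z}\}$ ($L_m,I_m$ even, $G_m$ odd) and super-brackets $$[L_m,L_n]=(n-m)L_{m+n},\quad [L_m,G_n]=nG_{m+n},\quad [L_m,I_n]=nI_{m+n},\quad [G_m,G_n]=2I_{m+n},\quad [I_m,I_n]=[I_m,G_n]=0$$ for $m,n\in\mathbb{Z}$. The super Heisenberg-Virasoro algebra of Neveu-Schwarz type $\mathcal{T}$ is the Lie superalgebra with basis $\{L_m,I_m,G_r\mid m\in\mathbb{Z},\,r\in\frac12+\mathbb{Z}\}$ ($L_m,I_m$ even, $G_r$ odd) and non-trivial relations $$[L_m,L_n]=(n-m)L_{m+n},\quad [L_m,I_n]=nI_{m+n},\quad [L_m,G_r]=rG_{m+r},\quad [G_r,G_s]=2I_{r+s}$$ for $m,n\in\mathbb{Z}$, $r,s\in\frac12+\mathbb{Z}$. *)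

(* Defs.v *)
From HB Require Import structures.
From mathcomp Require Import all_boot all_order all_algebra.
From mathcomp Require Import finmap monalg complex reals ring.

Set Implicit Arguments.
Unset Strict Implicit.
Unset Printing Implicit Defensive.

Import Order.TTheory GRing.Theory Num.Theory.
Local Open Scope ring_scope.

(* The degree group Z/2 is bool: hpart false is the even part and hpart true  *)
(* the odd part.  The Jacobi identity is the one saying that ad x is a        *)
(* superderivation of degree |x|.                                             *)
HB.mixin Record Lmodule_isLieSuperalgebra (K : numFieldType) (V : Type)
    of GRing.Lmodule K V := {
  hpart : bool -> {pred V};
  sbracket : V -> V -> V;
  hpart_submod : forall a, submod_closed (hpart a);
  hpart_sum : forall x, exists x0 x1,
    [/\ x0 \in hpart false, x1 \in hpart true & x = x0 + x1];
  hpart_cap : forall x, x \in hpart false -> x \in hpart true -> x = 0;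
  sbracket_linearl : forall y, linear (sbracket^~ y);
  sbracket_linearr : forall x, linear (sbracket x);
  sbracket_hpart : forall a b x y,
    x \in hpart a -> y \in hpart b -> sbracket x y \in hpart (a (+) b);
  sbracket_skew : forall a b x y, x \in hpart a -> y \in hpart b ->
    sbracket x y = - ((-1) ^+ (a && b) *: sbracket y x);
  sbracket_jacobi : forall a b x y z, x \in hpart a -> y \in hpart b ->
    sbracket x (sbracket y z) =
      sbracket (sbracket x y) z + (-1) ^+ (a && b) *: sbracket y (sbracket x z)
}.

#[short(type="lieSuperalgType")]
HB.structure Definition LieSuperalgebra (K : numFieldType) :=
  { V of Lmodule_isLieSuperalgebra K V & GRing.Lmodule K V }.

Section Morphisms.
Variables (K : numFieldType) (L M : lieSuperalgType K).

Definition lie_superhom (f : L -> M) : Prop :=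
  [/\ linear f,
      forall a x, x \in hpart a -> f x \in hpart a
    & forall x y, f (sbracket x y) = sbracket (f x) (f y)].

Definition lie_superisomorphic : Prop :=
  exists2 f : L -> M, lie_superhom f & bijective f.

End Morphisms.

Section Subalgebra.
Variables (K : numFieldType) (L : lieSuperalgType K).

(* Subalgebras of a Lie superalgebra are Z/2-graded subspaces.                *)
Record subsuperalg := SubSuperalg {
  subsuperalg_pred :> {pred L};
  subsuperalg_submod : submod_closed subsuperalg_pred;
  subsuperalg_graded : forall x0 x1, x0 \in hpart false -> x1 \in hpart true ->
    x0 + x1 \in subsuperalg_pred ->
    x0 \in subsuperalg_pred /\ x1 \in subsuperalg_pred;
  subsuperalg_bracket : forall x y, x \in subsuperalg_pred ->
    y \in subsuperalg_pred -> sbracket x y \in subsuperalg_pred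
}.

Variable W : subsuperalg.

HB.instance Definition _ :=
  GRing.isSubmodClosed.Build K L (subsuperalg_pred W)
    (GRing.submod_closed_semi (subsuperalg_submod W)).

Record subsuperalg_of := SubsuperalgElt {
  subsuperalg_val : L;
  _ : subsuperalg_val \in subsuperalg_pred W
}.

HB.instance Definition _ := [isSub for subsuperalg_val].
HB.instance Definition _ := [Choice of subsuperalg_of by <:].
HB.instance Definition _ :=
  [SubChoice_isSubLmodule of subsuperalg_of by <:].

Definition sub_hpart (a : bool) : {pred subsuperalg_of} :=
  [pred x | val x \in hpart a].

Definition sub_bracket (x y : subsuperalg_of) : subsuperalg_of :=
  SubsuperalgElt (subsuperalg_bracket (valP x) (valP y)).

Lemma sub_hpart_submod a : submod_closed (sub_hpart a).
Proof.
have [h0 hD] := hpart_submod (s := L) a.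
split; first by rewrite inE raddf0.
by move=> c x y hx hy; rewrite inE linearP; apply: hD.
Qed.

Lemma sub_hpart_sum x : exists x0 x1,
  [/\ x0 \in sub_hpart false, x1 \in sub_hpart true & x = x0 + x1].
Proof.
have [x0 [x1 [h0 h1 e]]] := hpart_sum (val x).
have [w0 w1] : x0 \in subsuperalg_pred W /\ x1 \in subsuperalg_pred W.
  by apply: subsuperalg_graded => //; rewrite -e; apply: valP.
exists (SubsuperalgElt w0), (SubsuperalgElt w1); split=> //.
by apply: val_inj; rewrite raddfD.
Qed.

Lemma sub_hpart_cap x : x \in sub_hpart false -> x \in sub_hpart true -> x = 0.
Proof.
by move=> h0 h1; apply: val_inj; rewrite raddf0; apply: hpart_cap.
Qed.

Lemma sub_bracket_linearl y : linear (sub_bracket^~ y).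
Proof.
move=> c x x'; apply: val_inj; rewrite [RHS]linearP /=.
by rewrite -sbracket_linearl -[_ *: _ + _](linearP (val : subsuperalg_of -> L)).
Qed.

Lemma sub_bracket_linearr x : linear (sub_bracket x).
Proof.
move=> c y y'; apply: val_inj; rewrite [RHS]linearP /=.
by rewrite -sbracket_linearr -[_ *: _ + _](linearP (val : subsuperalg_of -> L)).
Qed.

Lemma sub_bracket_hpart a b x y : x \in sub_hpart a -> y \in sub_hpart b ->
  sub_bracket x y \in sub_hpart (a (+) b).
Proof. by move=> hx hy; rewrite inE; apply: sbracket_hpart. Qed.

Lemma sub_bracket_skew a b x y : x \in sub_hpart a -> y \in sub_hpart b ->
  sub_bracket x y = - ((-1) ^+ (a && b) *: sub_bracket y x).
Proof.
move=> hx hy; apply: val_inj; rewrite [RHS]raddfN [X in - X]linearZ /=.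
exact: sbracket_skew hx hy.
Qed.

Lemma sub_bracket_jacobi a b x y z : x \in sub_hpart a -> y \in sub_hpart b ->
  sub_bracket x (sub_bracket y z) =
    sub_bracket (sub_bracket x y) z
    + (-1) ^+ (a && b) *: sub_bracket y (sub_bracket x z).
Proof.
move=> hx hy; apply: val_inj; rewrite [RHS]raddfD [X in _ + X]linearZ /=.
exact: sbracket_jacobi hx hy.
Qed.

HB.instance Definition _ := Lmodule_isLieSuperalgebra.Build K subsuperalg_of
  sub_hpart_submod sub_hpart_sum sub_hpart_cap sub_bracket_linearl
  sub_bracket_linearr sub_bracket_hpart sub_bracket_skew sub_bracket_jacobi.

End Subalgebra.

Section FreeModule.
Variables (K : numFieldType) (B : choiceType).

Definition lin_ext (V : lmodType K) (f : B -> V) (x : {malg K[B]}) : V :=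
  \sum_(i <- msupp x) x@_i *: f i.

Lemma lin_extEw (V : lmodType K) (f : B -> V) (d : {fset B}) x :
  (msupp x `<=` d)%fset -> lin_ext f x = \sum_(i <- d) x@_i *: f i.
Proof.
move=> le; rewrite /lin_ext; apply: big_fset_incl => // i _ hi.
by rewrite mcoeff_outdom // scale0r.
Qed.

Lemma lin_ext_linear (V : lmodType K) (f : B -> V) : linear (lin_ext f).
Proof.
move=> c x y; set d := (msupp x `|` msupp y)%fset.
have hx : (msupp x `<=` d)%fset by apply: fsubsetUl.
have hy : (msupp y `<=` d)%fset by apply: fsubsetUr.
have hc : (msupp (c *: x + y) `<=` d)%fset.
  apply: fsubset_trans (msuppD_le _ _) _; apply: fsetSU; exact: msuppZ_le.
rewrite (lin_extEw f hx) (lin_extEw f hy) (lin_extEw f hc) scaler_sumr -big_split.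
by apply: eq_bigr => i _; rewrite mcoeffD mcoeffZ scalerDl scalerA.
Qed.

Lemma lin_extU (V : lmodType K) (f : B -> V) i : lin_ext f << i >> = f i.
Proof. by rewrite /lin_ext msuppU oner_eq0 big_seq_fset1 mcoeffUU scale1r. Qed.

Lemma malg_decomp (x : {malg K[B]}) : x = \sum_(i <- msupp x) x@_i *: << i >>.
Proof.
rewrite {1}[x]monalgE; apply: eq_bigr => i _; apply/malgP => k.
by rewrite mcoeffZ !mcoeffU mulrnAr mulr1.
Qed.

Variable par : B -> bool.

Definition malg_hpart (a : bool) : {pred {malg K[B]}} :=
  [pred x : {malg K[B]} | all (fun i => par i == a) (msupp x)].

Lemma malg_hpartP a (x : {malg K[B]}) :
  reflect (forall i, x@_i != 0 -> par i = a) (x \in malg_hpart a).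
Proof.
apply: (iffP allP) => h i.
  by rewrite mcoeff_neq0 => /h /eqP.
by rewrite -mcoeff_neq0 => /h ->.
Qed.

Lemma malg_hpart_submod a : submod_closed (malg_hpart a).
Proof.
split; first by apply/malg_hpartP => i; rewrite mcoeff0 eqxx.
move=> c x y /malg_hpartP hx /malg_hpartP hy; apply/malg_hpartP => i.
rewrite mcoeffD mcoeffZ => nz; have [x0|/hx //] := eqVneq (x@_i) 0.
by apply: hy; move: nz; rewrite x0 mulr0 add0r.
Qed.

Lemma malg_hpartU a i : par i = a -> << i >> \in malg_hpart a.
Proof.
move=> h; apply/malg_hpartP => j; rewrite mcoeffU.
by have [<-|_] := eqVneq i j; rewrite ?mulr0n ?eqxx.
Qed.

Lemma malg_hpartZU a c i : par i = a -> c *: << i >> \in malg_hpart a.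
Proof.
move=> h; apply/malg_hpartP => j; rewrite mcoeffZ mcoeffU.
by have [<-|_] := eqVneq i j; rewrite ?mulr0n ?mulr0 ?eqxx.
Qed.

Lemma malg_hpart_cond_sum a (x : {malg K[B]}) :
  \sum_(i <- msupp x | par i == a) x@_i *: << i >> \in malg_hpart a.
Proof.
have [h0 hD] := malg_hpart_submod a.
apply: (big_ind (fun y => y \in malg_hpart a)) => // [y z hy hz|i /eqP hi].
  by rewrite -[y]scale1r; apply: hD.
exact: malg_hpartZU.
Qed.

Lemma malg_hpart_sum (x : {malg K[B]}) : exists x0 x1,
  [/\ x0 \in malg_hpart false, x1 \in malg_hpart true & x = x0 + x1].
Proof.
exists (\sum_(i <- msupp x | par i == false) x@_i *: << i >>).
exists (\sum_(i <- msupp x | par i == true) x@_i *: << i >>).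
split; [exact: malg_hpart_cond_sum|exact: malg_hpart_cond_sum|].
rewrite {1}[x]malg_decomp (bigID (fun i => par i == false)) /=; congr (_ + _).
by apply: eq_bigl => i; case: (par i).
Qed.

Lemma malg_hpart_cap (x : {malg K[B]}) :
  x \in malg_hpart false -> x \in malg_hpart true -> x = 0.
Proof.
move=> /malg_hpartP h0 /malg_hpartP h1; apply/malgP => i; rewrite mcoeff0.
by apply/eqP/negPn/negP => nz; have := h0 _ nz; rewrite (h1 _ nz).
Qed.

Lemma malg_ind (P : {malg K[B]} -> Prop) (Q : pred B) :
    P 0 -> (forall c x y, P x -> P y -> P (c *: x + y)) ->
    (forall i, Q i -> P << i >>) ->
  forall x, (forall i, x@_i != 0 -> Q i) -> P x.
Proof.
move=> P0 PD PU x hx; rewrite [x]malg_decomp big_seq.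
apply: big_ind => // [y z hy hz|i]; first by rewrite -[y]scale1r; apply: PD.
by rewrite -mcoeff_neq0 => /hx hi; rewrite -[_ *: _]addr0; apply/PD/P0/PU.
Qed.

Lemma malg_hpart_ind (P : {malg K[B]} -> Prop) a :
    P 0 -> (forall c x y, P x -> P y -> P (c *: x + y)) ->
    (forall i, par i = a -> P << i >>) ->
  forall x, x \in malg_hpart a -> P x.
Proof.
move=> P0 PD PU x /malg_hpartP hx.
apply: (malg_ind (Q := fun i => par i == a)) => // [i /eqP|i /hx ->] //.
exact: PU.
Qed.

(* Bilinear extension of a bracket prescribed on basis elements.              *)
Variable br : B -> B -> {malg K[B]}.

Definition malg_bracket (x y : {malg K[B]}) : {malg K[B]} :=
  lin_ext (fun i => lin_ext (br i) y) x.

Lemma malg_bracketU i j : malg_bracket << i >> << j >> = br i j.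
Proof. by rewrite /malg_bracket !lin_extU. Qed.

Lemma malg_bracket_linearl y : linear (malg_bracket^~ y).
Proof. exact: lin_ext_linear. Qed.

Lemma malg_bracket_linearr x : linear (malg_bracket x).
Proof.
move=> c y z; rewrite /malg_bracket /lin_ext scaler_sumr -big_split /=.
apply: eq_bigr => i _; rewrite -!/(lin_ext _ _) lin_ext_linear.
by rewrite scalerDr !scalerA mulrC.
Qed.

Lemma malg_bracket0l y : malg_bracket 0 y = 0.
Proof. by have := malg_bracket_linearl y (-1) 0 0; rewrite !scaleN1r !addNr. Qed.
Lemma malg_bracket0r x : malg_bracket x 0 = 0.
Proof. by have := malg_bracket_linearr x (-1) 0 0; rewrite !scaleN1r !addNr. Qed.
Lemma malg_bracketZl c x y : malg_bracket (c *: x) y = c *: malg_bracket x y.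
Proof.
by have := malg_bracket_linearl y c x 0; rewrite malg_bracket0l !addr0.
Qed.
Lemma malg_bracketZr c x y : malg_bracket x (c *: y) = c *: malg_bracket x y.
Proof.
by have := malg_bracket_linearr x c y 0; rewrite malg_bracket0r !addr0.
Qed.

Hypothesis br_par : forall i j, br i j \in malg_hpart (par i (+) par j).
Hypothesis br_skew :
  forall i j, br i j = - ((-1) ^+ (par i && par j) *: br j i).
Hypothesis br_jacobi : forall i j k,
  malg_bracket << i >> (br j k) =
    malg_bracket (br i j) << k >>
    + (-1) ^+ (par i && par j) *: malg_bracket << j >> (br i k).

Lemma malg_bracket_hpart a b x y : x \in malg_hpart a -> y \in malg_hpart b ->
  malg_bracket x y \in malg_hpart (a (+) b).
Proof.
have [h0 hD] := malg_hpart_submod (a (+) b).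
move=> hx hy; move: x hx; apply: malg_hpart_ind => [|c x x' hx hx'|i hi].
- by rewrite malg_bracket0l.
- by rewrite malg_bracket_linearl; apply: hD.
move: y hy; apply: malg_hpart_ind => [|c y y' hy hy'|j hj].
- by rewrite malg_bracket0r.
- by rewrite malg_bracket_linearr; apply: hD.
by rewrite malg_bracketU -hi -hj.
Qed.

Lemma malg_bracket_skew a b x y : x \in malg_hpart a -> y \in malg_hpart b ->
  malg_bracket x y = - ((-1) ^+ (a && b) *: malg_bracket y x).
Proof.
move=> hx hy; move: x hx; apply: malg_hpart_ind => [|c x x' hx hx'|i hi].
- by rewrite malg_bracket0l malg_bracket0r scaler0 oppr0.
- rewrite malg_bracket_linearl malg_bracket_linearr hx hx'.
  by rewrite scalerDr opprD scalerN !scalerA mulrC.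
move: y hy; apply: malg_hpart_ind => [|c y y' hy hy'|j hj].
- by rewrite malg_bracket0l malg_bracket0r scaler0 oppr0.
- rewrite malg_bracket_linearl malg_bracket_linearr hy hy'.
  by rewrite scalerDr opprD scalerN !scalerA mulrC.
by rewrite !malg_bracketU br_skew hi hj.
Qed.

Lemma malg_bracket_jacobi a b x y z : x \in malg_hpart a -> y \in malg_hpart b ->
  malg_bracket x (malg_bracket y z) =
    malg_bracket (malg_bracket x y) z
    + (-1) ^+ (a && b) *: malg_bracket y (malg_bracket x z).
Proof.
move=> hx hy; move: x hx; apply: malg_hpart_ind => [|c x x' hx hx'|i hi].
- by rewrite !malg_bracket0l malg_bracket0r scaler0 addr0.
- rewrite !malg_bracket_linearl malg_bracket_linearr hx hx'.
  by rewrite !scalerDr !scalerA addrACA [c * _]mulrC.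
move: y hy; apply: malg_hpart_ind => [|c y y' hy hy'|j hj].
- by rewrite !malg_bracket0l malg_bracket0r malg_bracket0l scaler0 addr0.
- rewrite !malg_bracket_linearl !malg_bracket_linearr malg_bracket_linearl.
  by rewrite hy hy' !scalerDr !scalerA addrACA [c * _]mulrC.
have hz i' : z@_i' != 0 -> predT i' by [].
move: z hz; apply: malg_ind => [|c z z' hz hz'|k _].
- by rewrite !malg_bracket0r scaler0 addr0.
- rewrite !malg_bracket_linearr hz hz'.
  by rewrite !scalerDr !scalerA addrACA [c * _]mulrC.
by rewrite !malg_bracketU br_jacobi hi hj.
Qed.

End FreeModule.

Inductive ramond_index : Type := RL of int | RI of int | RG of int.

(* NG n is the index of the basis vector G_(n + 1/2).                         *)
Inductive ns_index : Type := NL of int | NI of int | NG of int.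

Definition ramond_index_code (i : ramond_index) : int + (int + int) :=
  match i with RL m => inl m | RI m => inr (inl m) | RG m => inr (inr m) end.
Definition ramond_index_decode (s : int + (int + int)) : ramond_index :=
  match s with inl m => RL m | inr (inl m) => RI m | inr (inr m) => RG m end.
Lemma ramond_index_codeK : cancel ramond_index_code ramond_index_decode.
Proof. by case. Qed.
HB.instance Definition _ :=
  Choice.copy ramond_index (can_type ramond_index_codeK).

Definition ns_index_code (i : ns_index) : int + (int + int) :=
  match i with NL m => inl m | NI m => inr (inl m) | NG m => inr (inr m) end.
Definition ns_index_decode (s : int + (int + int)) : ns_index :=
  match s with inl m => NL m | inr (inl m) => NI m | inr (inr m) => NG m end.
Lemma ns_index_codeK : cancel ns_index_code ns_index_decode.
Proof. by case. Qed.
HB.instance Definition _ := Choice.copy ns_index (can_type ns_index_codeK).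

Definition ramond_odd (i : ramond_index) : bool :=
  if i is RG _ then true else false.
Definition ns_odd (i : ns_index) : bool :=
  if i is NG _ then true else false.

Section HeisenbergVirasoro.
Variable K : numFieldType.

Definition ramond_br (i j : ramond_index) : {malg K[ramond_index]} :=
  match i, j with
  | RL m, RL n => (n - m)%:~R *: << RL (m + n) >>
  | RL m, RI n => n%:~R *: << RI (m + n) >>
  | RI m, RL n => - (m%:~R *: << RI (m + n) >>)
  | RL m, RG n => n%:~R *: << RG (m + n) >>
  | RG m, RL n => - (m%:~R *: << RG (m + n) >>)
  | RG m, RG n => 2 *: << RI (m + n) >>
  | _, _ => 0
  end.

(* With r = m + 1/2 and s = n + 1/2 one has r + s = m + n + 1.                *)
Definition ns_br (i j : ns_index) : {malg K[ns_index]} :=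
  match i, j with
  | NL m, NL n => (n - m)%:~R *: << NL (m + n) >>
  | NL m, NI n => n%:~R *: << NI (m + n) >>
  | NI m, NL n => - (m%:~R *: << NI (m + n) >>)
  | NL m, NG n => (n%:~R + 2^-1) *: << NG (m + n) >>
  | NG m, NL n => - ((m%:~R + 2^-1) *: << NG (m + n) >>)
  | NG m, NG n => 2 *: << NI (m + n + 1) >>
  | _, _ => 0
  end.

Lemma ramond_br_par i j :
  ramond_br i j \in malg_hpart ramond_odd (ramond_odd i (+) ramond_odd j).
Proof.
have [h0 _] := @malg_hpart_submod K _ ramond_odd (ramond_odd i (+) ramond_odd j).
by case: i j h0 => m [] n //= h0; rewrite -?scaleNr; apply: malg_hpartZU.
Qed.

Lemma ns_br_par i j : ns_br i j \in malg_hpart ns_odd (ns_odd i (+) ns_odd j).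
Proof.
have [h0 _] := @malg_hpart_submod K _ ns_odd (ns_odd i (+) ns_odd j).
by case: i j h0 => m [] n //= h0; rewrite -?scaleNr; apply: malg_hpartZU.
Qed.

Lemma ramond_br_skew i j : ramond_br i j =
  - ((-1) ^+ (ramond_odd i && ramond_odd j) *: ramond_br j i).
Proof.
case: i j => m [] n; rewrite /ramond_br /ramond_odd /=.
all: try move: (@mkmalgU _ _) => X.
all: rewrite ?expr0 ?expr1 ?scale1r ?scaleN1r ?opprK ?scaler0 ?oppr0.
all: rewrite ?[n + m]addrC //.
by rewrite -scaleNr -rmorphN opprB.
Qed.

Lemma ns_br_skew i j : ns_br i j =
  - ((-1) ^+ (ns_odd i && ns_odd j) *: ns_br j i).
Proof.
case: i j => m [] n; rewrite /ns_br /ns_odd /=.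
all: try move: (@mkmalgU _ _) => X.
all: rewrite ?expr0 ?expr1 ?scale1r ?scaleN1r ?opprK ?scaler0 ?oppr0.
all: rewrite ?[n + m]addrC //.
by rewrite -scaleNr -rmorphN opprB.
Qed.

Lemma ramond_br_jacobi i j k :
  malg_bracket ramond_br << i >> (ramond_br j k) =
    malg_bracket ramond_br (ramond_br i j) << k >>
    + (-1) ^+ (ramond_odd i && ramond_odd j) *:
        malg_bracket ramond_br << j >> (ramond_br i k).
Proof.
(* Unification must not unfold the finitely supported functions.              *)
move: (malg_bracketU ramond_br) (malg_bracketZl ramond_br)
  (malg_bracketZr ramond_br) (malg_bracket0l ramond_br) (malg_bracket0r ramond_br).
move: (malg_bracket _) => f; rewrite /ramond_br; move: (@mkmalgU _ _) => X.
move=> fU fZl fZr f0l f0r.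
have fNl x y : f (- x) y = - f x y by rewrite -scaleN1r fZl scaleN1r.
have fNr x y : f x (- y) = - f x y by rewrite -scaleN1r fZr scaleN1r.
case: i j k => m [] n [] p /=; rewrite ?(fNl, fNr, fZl, fZr, f0l, f0r, fU).
all: rewrite -?scaleNr ?scalerA ?scaler0 ?addr0 ?add0r -?addrA ?(addrCA n m).
all: rewrite -?scalerDl; try by [].
all: by congr (_ *: _); ring.
Qed.

Lemma ns_br_jacobi i j k :
  malg_bracket ns_br << i >> (ns_br j k) =
    malg_bracket ns_br (ns_br i j) << k >>
    + (-1) ^+ (ns_odd i && ns_odd j) *:
        malg_bracket ns_br << j >> (ns_br i k).
Proof.
(* Unification must not unfold the finitely supported functions.              *)
move: (malg_bracketU ns_br) (malg_bracketZl ns_br)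
  (malg_bracketZr ns_br) (malg_bracket0l ns_br) (malg_bracket0r ns_br).
move: (malg_bracket _) => f; rewrite /ns_br; move: (@mkmalgU _ _) => X.
move=> fU fZl fZr f0l f0r.
have fNl x y : f (- x) y = - f x y by rewrite -scaleN1r fZl scaleN1r.
have fNr x y : f x (- y) = - f x y by rewrite -scaleN1r fZr scaleN1r.
case: i j k => m [] n [] p /=; rewrite ?(fNl, fNr, fZl, fZr, f0l, f0r, fU).
all: rewrite -?scaleNr ?scalerA ?scaler0 ?addr0 ?add0r -?addrA ?(addrCA n m).
all: rewrite ?[1 + p]addrC -?scalerDl; try by [].
all: by congr (_ *: _); field.
Qed.

Definition ramond_alg : Type := {malg K[ramond_index]}.
Definition ns_alg : Type := {malg K[ns_index]}.

HB.instance Definition _ := GRing.Lmodule.on ramond_alg.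
HB.instance Definition _ := Lmodule_isLieSuperalgebra.Build K ramond_alg
  (@malg_hpart_submod K _ ramond_odd) (malg_hpart_sum ramond_odd)
  (@malg_hpart_cap K _ ramond_odd)
  (malg_bracket_linearl ramond_br) (malg_bracket_linearr ramond_br)
  (malg_bracket_hpart ramond_br_par) (malg_bracket_skew ramond_br_skew)
  (malg_bracket_jacobi ramond_br_jacobi).

HB.instance Definition _ := GRing.Lmodule.on ns_alg.
HB.instance Definition _ := Lmodule_isLieSuperalgebra.Build K ns_alg
  (@malg_hpart_submod K _ ns_odd) (malg_hpart_sum ns_odd)
  (@malg_hpart_cap K _ ns_odd)
  (malg_bracket_linearl ns_br) (malg_bracket_linearr ns_br)
  (malg_bracket_hpart ns_br_par) (malg_bracket_skew ns_br_skew)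
  (malg_bracket_jacobi ns_br_jacobi).

Lemma ramond_sbracketE i j :
  sbracket (<< i >> : ramond_alg) (<< j >> : ramond_alg) = ramond_br i j.
Proof. exact: malg_bracketU. Qed.

Lemma ns_sbracketE i j :
  sbracket (<< i >> : ns_alg) (<< j >> : ns_alg) = ns_br i j.
Proof. exact: malg_bracketU. Qed.

Definition ramondL (m : int) : ramond_alg := << RL m >>.
Definition ramondI (m : int) : ramond_alg := << RI m >>.
Definition ramondG (m : int) : ramond_alg := << RG m >>.

Definition nsL (m : int) : ns_alg := << NL m >>.
Definition nsI (m : int) : ns_alg := << NI m >>.
(* nsG m is G_(m + 1/2).                                                      *)
Definition nsG (m : int) : ns_alg := << NG m >>.

Definition ns_to_ramond : ns_alg -> ramond_alg :=
  lin_ext (fun i : ns_index => match i return ramond_alg with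
    | NL m => 2^-1 *: ramondL (2 * m)
    | NI m => ramondI (2 * m)
    | NG m => ramondG (2 * m + 1)
    end).

End HeisenbergVirasoro.

(* Main.v *)
Require Import Defs.
From mathcomp Require Import all_boot all_order all_algebra.
From mathcomp Require Import complex reals.
From mathcomp Require Import monalg ring.
Set Implicit Arguments.
Unset Strict Implicit.
Unset Printing Implicit Defensive.

Import GRing.Theory.
Local Open Scope ring_scope.

(* Halving all degrees, with rounding down, and doubling the vectors L_m gives *)
(* a linear left inverse of psi.  Hence psi is injective, and its image is the *)
(* decidable set of the y fixed by psi composed with that inverse; the image   *)
(* is graded because psi preserves parity and the even and odd parts of the    *)
(* target meet in 0.                                                           *)

(** The map doubles every degree, taking [G] of degree m + 1/2 to degree 2m + 1, so degrees still
    add up. Brackets with [L_m] are weighted by degrees, which have doubled, and the factor 1/2 on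
    [L] cancels this: [L_{2m}/2, L_{2n}/2] = (n - m) L_{2(m+n)}/2, and L_{2m}/2 acts on [I_{2n}] and
    [G_{2n+1}] by n and n + 1/2. The bracket of two [G] has a constant coefficient and gives [I],
    which is not rescaled. This is [ns_to_ramond_bracketU]; bilinearity extends it to all vectors.
    Injectivity comes from the left inverse in [ns_to_ramondK], and [lie_superhom_embedding] turns a
    homomorphism with a left inverse into an isomorphism onto a graded subalgebra. *)

Section LinearMaps.
Variable K : numFieldType.

Lemma linear_map0 (U V : lmodType K) (f : U -> V) : linear f -> f 0 = 0.
Proof. by move=> lf; have := lf (-1) 0 0; rewrite !scaleN1r !addNr. Qed.

Lemma linear_mapZ (U V : lmodType K) (f : U -> V) c x :
  linear f -> f (c *: x) = c *: f x.
Proof. by move=> lf; have := lf c x 0; rewrite (linear_map0 lf) !addr0. Qed.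

End LinearMaps.

Section Embedding.
Variables (K : numFieldType) (L M : lieSuperalgType K).

Section Image.
Variables (f : L -> M) (g : M -> L).
Hypotheses (f_hom : lie_superhom f) (fK : cancel f g).

Definition superhom_image : {pred M} := [pred y | f (g y) == y].

Lemma superhom_imageP y : reflect (exists x, y = f x) (y \in superhom_image).
Proof.
apply: (iffP eqP) => [<-|[x ->]]; first by exists (g y).
by rewrite fK.
Qed.

Lemma superhom_image_submod : submod_closed superhom_image.
Proof.
have [f_lin _ _] := f_hom; split=> [|c _ _ /superhom_imageP[x ->] /superhom_imageP[y ->]].
  by apply/superhom_imageP; exists 0; rewrite (linear_map0 f_lin).
by apply/superhom_imageP; exists (c *: x + y); rewrite f_lin.
Qed.

Lemma superhom_image_graded x0 x1 :
    x0 \in hpart false -> x1 \in hpart true -> x0 + x1 \in superhom_image ->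
  x0 \in superhom_image /\ x1 \in superhom_image.
Proof.
have [f_lin f_par _] := f_hom.
move=> x0P x1P /superhom_imageP[x xE].
have [y0 [y1 [y0P y1P yE]]] := hpart_sum x.
have fyE : x0 + x1 = f y0 + f y1.
  by rewrite xE yE -[y0]scale1r f_lin !scale1r.
(* The left side is even and the right side is odd, so both vanish. *)
have d01 : x0 - f y0 = f y1 - x1.
  by apply/eqP; rewrite subr_eq addrAC eq_sym subr_eq addrC -fyE.
have hpartB a u v : u \in hpart a -> v \in hpart a -> u - v \in @hpart K M a.
  by move=> uP vP; rewrite addrC -scaleN1r; apply: (hpart_submod _).2.
have d0 : x0 - f y0 = 0.
  apply: hpart_cap; first by apply: hpartB => //; apply: f_par.
  by rewrite d01; apply: hpartB => //; apply: f_par.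
split; apply/superhom_imageP.
  by exists y0; apply/eqP; rewrite -subr_eq0 d0.
by exists y1; apply/eqP; rewrite eq_sym -subr_eq0 -d01 d0.
Qed.

Lemma superhom_image_bracket x y :
  x \in superhom_image -> y \in superhom_image ->
  sbracket x y \in superhom_image.
Proof.
have [_ _ f_br] := f_hom.
move=> /superhom_imageP[u ->] /superhom_imageP[v ->].
by apply/superhom_imageP; exists (sbracket u v).
Qed.

Definition superhom_image_subalg : subsuperalg M :=
  SubSuperalg superhom_image_submod superhom_image_graded
    superhom_image_bracket.

Lemma superhom_image_subalgP x : f x \in superhom_image_subalg.
Proof. by apply/superhom_imageP; exists x. Qed.

Lemma superhom_image_isomorphic :
  lie_superisomorphic L (subsuperalg_of superhom_image_subalg).
Proof.
have [f_lin f_par f_br] := f_hom.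
exists (fun x => SubsuperalgElt (superhom_image_subalgP x)).
  split=> [c x y|a x xP|x y].
  - by apply: val_inj; rewrite [RHS]linearP /= f_lin.
  - by rewrite inE; apply: f_par.
  - by apply: val_inj; rewrite /= f_br.
(* Membership in the image is by definition the equation [f (g y) == y], which is the other
   cancellation law. *)
exists (fun y => g (val y)) => [x|y]; first exact: fK.
by apply: val_inj; apply/eqP; apply: (valP y).
Qed.

End Image.

Lemma lie_superhom_embedding (f : L -> M) (g : M -> L) :
    lie_superhom f -> cancel f g ->
  exists W : subsuperalg M, lie_superisomorphic L (subsuperalg_of W).
Proof. by move=> f_hom fK; eexists; apply: (superhom_image_isomorphic f_hom fK). Qed.

End Embedding.

Section FreeModuleMaps.
Variables (K : numFieldType) (B : choiceType).

Lemma malg_all_ind (P : {malg K[B]} -> Prop) :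
    P 0 -> (forall c x y, P x -> P y -> P (c *: x + y)) ->
    (forall i, P << i >>) ->
  forall x, P x.
Proof. by move=> P0 PD PU x; apply: (@malg_ind _ _ P predT). Qed.

Lemma malg_linear_eq (V : lmodType K) (f g : {malg K[B]} -> V) :
  linear f -> linear g -> (forall i, f << i >> = g << i >>) -> f =1 g.
Proof.
move=> lf lg fg; apply: malg_all_ind => // [|c x y fx fy].
  by rewrite !linear_map0.
by rewrite lf lg fx fy.
Qed.

(** This reduces the homomorphism law for brackets to a comparison of structure constants. *)
Lemma malg_bilinear_eq (V : lmodType K) (f g : {malg K[B]} -> {malg K[B]} -> V) :
    (forall y, linear (f^~ y)) -> (forall x, linear (f x)) ->
    (forall y, linear (g^~ y)) -> (forall x, linear (g x)) ->
    (forall i j, f << i >> << j >> = g << i >> << j >>) ->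
  forall x y, f x y = g x y.
Proof.
move=> lfl lfr lgl lgr fg x y.
apply: (malg_linear_eq (lfl y) (lgl y)) x => i.
exact: (malg_linear_eq (lfr _) (lgr _)) (fg i) y.
Qed.

End FreeModuleMaps.

Section NeveuSchwarzToRamond.
Variable K : numFieldType.

Local Notation psi := (@ns_to_ramond K).

Lemma ns_to_ramond_linear : linear psi.
Proof. exact: lin_ext_linear. Qed.

Lemma ns_to_ramondL m : psi (nsL _ m) = 2^-1 *: ramondL _ (2 * m).
Proof. exact: lin_extU. Qed.

Lemma ns_to_ramondI m : psi (nsI _ m) = ramondI _ (2 * m).
Proof. exact: lin_extU. Qed.

Lemma ns_to_ramondG m : psi (nsG _ m) = ramondG _ (2 * m + 1).
Proof. exact: lin_extU. Qed.

(** Since [%/] rounds down for negative integers too, both 2m and 2m + 1 go to m, so one formula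
    undoes the even and the odd shifts. The values on [RL] and [RI] of odd degree and on [RG] of
    even degree are defaults: these vectors lie outside the image of psi. *)
Definition ramond_to_ns : ramond_alg K -> ns_alg K :=
  lin_ext (fun i : ramond_index => match i return ns_alg K with
    | RL m => 2 *: nsL K (m %/ 2)%Z
    | RI m => nsI K (m %/ 2)%Z
    | RG m => nsG K (m %/ 2)%Z
    end).

Lemma ramond_to_ns_linear : linear ramond_to_ns.
Proof. exact: lin_ext_linear. Qed.

Lemma ns_to_ramondK : cancel psi ramond_to_ns.
Proof.
have half m : ((2 * m) %/ 2)%Z = m by rewrite mulKz.
have half1 m : ((2 * m + 1) %/ 2)%Z = m by rewrite mulrC divzMDl // addr0.
apply: (malg_linear_eq (f := ramond_to_ns \o psi) (g := id)) => //.
  by move=> c x y /=; rewrite ns_to_ramond_linear ramond_to_ns_linear.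
case=> m /=.
- rewrite [psi _]ns_to_ramondL (linear_mapZ _ _ ramond_to_ns_linear).
  rewrite [ramond_to_ns _]lin_extU half scalerA mulVf ?scale1r //.
  by rewrite Num.Theory.pnatr_eq0.
- by rewrite [psi _]ns_to_ramondI [ramond_to_ns _]lin_extU half.
- by rewrite [psi _]ns_to_ramondG [ramond_to_ns _]lin_extU half1.
Qed.

Lemma ns_to_ramond_hpart a x : x \in hpart a -> psi x \in hpart a.
Proof.
move: x; apply: malg_hpart_ind => [|c x y hx hy|[] m <-].
- by rewrite (linear_map0 ns_to_ramond_linear); apply: (hpart_submod _).1.
- by rewrite ns_to_ramond_linear; apply: (hpart_submod _).2.
- by rewrite [psi _]ns_to_ramondL; apply: malg_hpartZU.
- by rewrite [psi _]ns_to_ramondI; apply: malg_hpartU.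
- by rewrite [psi _]ns_to_ramondG; apply: malg_hpartU.
Qed.

Lemma ns_to_ramond_bracketU i j :
  psi (ns_br K i j) = sbracket (psi << i >>) (psi << j >>).
Proof.
have psiZ := linear_mapZ _ _ ns_to_ramond_linear.
have psi0 := linear_map0 ns_to_ramond_linear.
have psiN x : psi (- x) = - psi x by rewrite -scaleN1r psiZ scaleN1r.
have psiL m : psi << NL m >> = 2^-1 *: << RL (2 * m) >> := ns_to_ramondL m.
have psiI m : psi << NI m >> = << RI (2 * m) >> := ns_to_ramondI m.
have psiG m : psi << NG m >> = << RG (2 * m + 1) >> := ns_to_ramondG m.
have sbZl c (x y : ramond_alg K) : sbracket (c *: x) y = c *: sbracket x y.
  by apply: (linear_mapZ _ _ (sbracket_linearl y)).
have sbZr c (x y : ramond_alg K) : sbracket x (c *: y) = c *: sbracket x y.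
  by apply: (linear_mapZ _ _ (sbracket_linearr x)).
have scale_eq (a b : K) (x y : ramond_alg K) : a = b -> x = y -> a *: x = b *: y.
  by move=> -> ->.
have := @ramond_sbracketE K; rewrite /ramond_br.
(* Unification must not unfold the finitely supported functions.              *)
move: (@sbracket K (ramond_alg K)) sbZl sbZr => sb sbZl sbZr.
move: (@mkmalgU ramond_index K) psiL psiI psiG => X psiL psiI psiG sbU.
case: i j => m [] n; rewrite /ns_br ?(psiN, psiZ, psi0, psiL, psiI, psiG).
all: rewrite ?sbZl ?sbZr ?sbU ?scaler0 //.
all: rewrite ?scalerN ?scalerA -?scaleNr.
(* Both sides are now multiples of a single basis vector. The degrees agree over [int], for instance
   2(m + n + 1) = (2m + 1) + (2n + 1); the coefficients, such as n + 1/2 = (2n + 1)/2, are left to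
   [field]. *)
all: apply: scale_eq; last by apply: (congr1 (X^~ 1)); f_equal; ring.
all: by field.
Qed.

Lemma ns_to_ramond_bracket x y :
  psi (sbracket x y) = sbracket (psi x) (psi y).
Proof.
have psi_lin := ns_to_ramond_linear.
apply: (@malg_bilinear_eq _ _ (ramond_alg K)
    (fun x y => psi (@sbracket K (ns_alg K) x y))
    (fun x y => @sbracket K (ramond_alg K) (psi x) (psi y)))
  => [z c u v|z c u v|z c u v|z c u v|i j].
- by rewrite sbracket_linearl psi_lin.
- by rewrite sbracket_linearr psi_lin.
- by rewrite psi_lin sbracket_linearl.
- by rewrite psi_lin sbracket_linearr.
by rewrite ns_sbracketE ns_to_ramond_bracketU.
Qed.

Lemma ns_to_ramond_superhom : lie_superhom psi.
Proof.
split; [exact: ns_to_ramond_linear|exact: ns_to_ramond_hpart|].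
exact: ns_to_ramond_bracket.
Qed.

End NeveuSchwarzToRamond.

Theorem mainTheorem4 (R : realType) :
  let psi : ns_alg R[i] -> ramond_alg R[i] := @ns_to_ramond R[i] in
  [/\ linear psi,
      [/\ forall m : int, psi (nsL _ m) = 2^-1 *: ramondL _ (2 * m),
          forall m : int, psi (nsI _ m) = ramondI _ (2 * m)
        & forall m : int, psi (nsG _ m) = ramondG _ (2 * m + 1)],
      lie_superhom psi,
      injective psi
    & exists W : subsuperalg (ramond_alg R[i]),
        lie_superisomorphic (ns_alg R[i]) (subsuperalg_of W)].
Proof.
move=> psi; split.
- exact: ns_to_ramond_linear.
- by split=> m; [exact: ns_to_ramondL|exact: ns_to_ramondI|exact: ns_to_ramondG].
- exact: ns_to_ramond_superhom.
- exact: can_inj (@ns_to_ramondK _).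
exact: lie_superhom_embedding (@ns_to_ramond_superhom _) (@ns_to_ramondK _).
Qed.
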